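(* For the $m$-sparse Bernoulli model with $\frac md\le\frac12$, suppose the power constraint is $P$, the channel noise variance is $\sigma_0^2$ and there are $s=d$ channel uses. Let $\sigma_{pri}^2=\max\{\frac{sP-2\epsilon\sigma_0^2}{2\epsilon n+s},0\}$ (with $s=d$). If $\frac{d^2}{4m(d-m)}(\sigma_0^2+n\sigma_{pri}^2)\le n^{3/2}(P-\sigma_{pri}^2)$, the minimax (worst-case over $\theta\in\Theta$) estimation error of the $\epsilon$-robust over-the-air estimation scheme is $$R_{robust}=\frac{m}{(\sqrt n+1)^2}\left(\frac{d-m}{d}+\frac{d}{2n\epsilon}\cdot\frac{d}{m\big(\sqrt{\frac{d-m}{m}}+\sqrt{\frac{m}{d-m}}\big)^2}\right).$$ Otherwise, $$R_{robust}=m\cdot\frac{1}{\frac{d}{d-m}+n\cdot\frac{2n\epsilon}{d}\cdot\frac{m\left(\sqrt{\frac{d-m}{m}}+\sqrt{\frac{m}{d-m}}\right)^2}{d}}.$$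
   Context: $m$-sparse Bernoulli model: $\Theta=\{\theta\in[0,1]^d:\sum_{k=1}^d\theta_k\le m\}$ and $p_\theta=\prod_{k=1}^d\mathrm{Bernoulli}(\theta_k)$ on $\{0,1\}^d$; the $n$ users hold $U_1,\dots,U_n$, i.i.d. with law $p_\theta$. $\epsilon$-robust over-the-air estimation scheme: it takes the minimax optimal over-the-air scheme (affine estimators, deterministic invertible encoding) for power constraint $P'=P-\sigma_{pri}^2$ and channel noise variance $\sigma'^2=\sigma_0^2+n\sigma_{pri}^2$, and adds independent local noise $\mathcal N(0,\sigma_{pri}^2I_d)$ at each user. Concretely, let $S=\sqrt{\frac{d-m}{m}}+\sqrt{\frac{m}{d-m}}$ and $D=\sqrt{\frac{d-m}{m}}-\sqrt{\frac{m}{d-m}}$, and define $f^*$ by $[f^*(u)]_j=-\sqrt{\frac{m}{d-m}P'}$ if $[u]_j=0$ and $[f^*(u)]_j=\sqrt{\frac{d-m}{m}P'}$ if $[u]_j=1$, where $[\cdot]_j$ is the $j$-th coordinate. User $i$ sends $X_i=f^*(U_i)+Z_{pri,i}$, where $Z_{pri,i}\sim\mathcal N(0,\sigma_{pri}^2I_d)$ are independent of each other and of the data. The processor receives $Y=\sum_{i=1}^nX_i+Z$, with channel noise $Z\sim\mathcal N(0,\sigma_0^2I_d)$ independent of everything else, and uses $\hat\theta(Y)=\alpha^*Y+\beta^*\mathbf 1$ ($\mathbf 1$ the all-ones vector), where $\alpha^*=\frac{1}{\sqrt{nP'}\,S(\sqrt n+1)}$ if $\frac{d^2}{4m(d-m)}\sigma'^2\le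 n^{3/2}P'$, $\alpha^*=\frac{m(d-m)n\sqrt{P'}S}{d^2\sigma'^2+m(d-m)n^2P'S^2}$ if $\frac{d^2}{4m(d-m)}\sigma'^2\ge n^{3/2}P'$, and $\beta^*=(1-\frac{2m}{d})\frac{n\sqrt{P'}}{2}S\alpha^*+\frac md-\frac{n\sqrt{P'}}{2}D\alpha^*$. The worst-case error is $R_{robust}=\sup_{\theta\in\Theta}\mathbb E_\theta\|\hat\theta(Y)-\theta\|_2^2$.
   Formalization: Two conditions are added, since the printed equalities fail without them: 2εσ_0² ≤ dP (so the max in σ_pri² is its first argument), and, in the ''Otherwise'' case only, n^{3/2}(P−σ_pri²) ≤ σ_0²+nσ_pri². *)

(* Defs.v *)
From HB Require Import structures.
From mathcomp Require Import all_boot all_order all_algebra.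
From mathcomp Require Import all_classical all_reals all_analysis.

Set Implicit Arguments.
Unset Strict Implicit.
Unset Printing Implicit Defensive.

Import Order.TTheory GRing.Theory Num.Theory.
Import numFieldNormedType.Exports.

Local Open Scope classical_set_scope.
Local Open Scope ring_scope.

Definition sqnorm2 (R : realType) (d : nat) (x : 'rV[R]_d) : R :=
  \sum_(j < d) x 0 j ^+ 2.

Definition sparse_params (R : realType) (d m : nat) : set 'rV[R]_d :=
  [set theta | (forall k, 0 <= theta 0 k <= 1) /\
               \sum_(k < d) theta 0 k <= m%:R].
Arguments sparse_params {R} d m.

Definition bernoulli_product_pmf (R : realType) (d : nat) (theta : 'rV[R]_d)
    (u : {ffun 'I_d -> bool}) : R :=
  \prod_(k < d) bernoulli_pmf (theta 0 k) (u k).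

(* N(0, v), parametrized by its variance. The case v = 0 is separated because
   [normal_prob 0 0] is the uniform law on [0, 1] and not the point mass at 0. *)
Definition centered_normal (R : realType) (v : R) (A : set R) : \bar R :=
  if v == 0 then \d_(0 : R) A else normal_prob 0 (Num.sqrt v) A.

Definition coord_event (disp : measure_display) (T : measurableType disp)
    (R : realType) (d : nat) (X : T -> 'rV[R]_d) : set (set T) :=
  [set E | exists (j : 'I_d) (B : set R),
             measurable B /\ E = (fun t => X t 0 j) @^-1` B].

(* X has law N(0, v I_d), the d-fold product of N(0, v); a probability measure
   on R^d is determined by its values on measurable boxes. *)
Definition has_isotropic_normal_law (disp : measure_display)
    (T : measurableType disp) (R : realType) (Pr : probability T R) (d : nat)
    (v : R) (X : T -> 'rV[R]_d) : Prop :=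
  (coord_event X `<=` measurable) /\
  forall B : 'I_d -> set R, (forall j, measurable (B j)) ->
    Pr [set t | forall j, B j (X t 0 j)] =
    (\prod_(j < d) centered_normal v (B j))%E.

Definition mutually_independent (disp : measure_display)
    (T : measurableType disp) (R : realType) (Pr : probability T R)
    (I : finType) (F : I -> set (set T)) : Prop :=
  forall (J : {set I}) (E : I -> set T),
    (forall i, i \in J -> F i (E i)) ->
    Pr (\bigcap_(i in [set` J]) E i) = (\prod_(i in J) Pr (E i))%E.

(* The sigma-algebras generated by U_i (index [inl i]), by Z_{pri,i}
   (index [inr (Some i)]) and by Z (index [inr None]). *)
Definition source_events (disp : measure_display) (T : measurableType disp)
    (R : realType) (d n : nat) (U : 'I_n -> T -> {ffun 'I_d -> bool})
    (Zpri : 'I_n -> T -> 'rV[R]_d) (Z : T -> 'rV[R]_d)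
    (k : 'I_n + option 'I_n) : set (set T) :=
  match k with
  | inl i => [set U i @^-1` B | B in [set: set {ffun 'I_d -> bool}]]
  | inr (Some i) => <<s coord_event (Zpri i) >>
  | inr None => <<s coord_event Z >>
  end.

Record bernoulli_channel_model (disp : measure_display)
    (T : measurableType disp) (R : realType) (Pr : probability T R) (d n : nat)
    (theta : 'rV[R]_d) (vpri v0 : R) (U : 'I_n -> T -> {ffun 'I_d -> bool})
    (Zpri : 'I_n -> T -> 'rV[R]_d) (Z : T -> 'rV[R]_d) : Prop := {
  model_data_measurable : forall i u, measurable (U i @^-1` [set u]) ;
  model_data_law : forall i u,
    Pr (U i @^-1` [set u]) = (bernoulli_product_pmf theta u)%:E ;
  model_local_noise_law : forall i, has_isotropic_normal_law Pr vpri (Zpri i) ;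
  model_channel_noise_law : has_isotropic_normal_law Pr v0 Z ;
  model_independent : mutually_independent Pr (source_events U Zpri Z)
}.

Definition odds_sum (R : realType) (d m : nat) : R :=
  Num.sqrt ((d%:R - m%:R) / m%:R) + Num.sqrt (m%:R / (d%:R - m%:R)).
Arguments odds_sum {R} d m.

Definition odds_diff (R : realType) (d m : nat) : R :=
  Num.sqrt ((d%:R - m%:R) / m%:R) - Num.sqrt (m%:R / (d%:R - m%:R)).
Arguments odds_diff {R} d m.

Definition encoder (R : realType) (d m : nat) (P' : R)
    (u : {ffun 'I_d -> bool}) : 'rV[R]_d :=
  \row_j (if u j then Num.sqrt ((d%:R - m%:R) / m%:R * P')
          else - Num.sqrt (m%:R / (d%:R - m%:R) * P')).

Definition low_noise (R : realType) (d n m : nat) (P' v' : R) : bool :=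
  d%:R ^+ 2 / (4 * m%:R * (d%:R - m%:R)) * v' <= n%:R `^ (3 / 2) * P'.

Definition alpha_star (R : realType) (d n m : nat) (P' v' : R) : R :=
  if low_noise d n m P' v' then
    (Num.sqrt (n%:R * P') * odds_sum d m * (Num.sqrt n%:R + 1))^-1
  else
    m%:R * (d%:R - m%:R) * n%:R * Num.sqrt P' * odds_sum d m /
    (d%:R ^+ 2 * v' +
     m%:R * (d%:R - m%:R) * n%:R ^+ 2 * P' * odds_sum d m ^+ 2).

Definition beta_star (R : realType) (d n m : nat) (P' v' : R) : R :=
  (1 - 2 * m%:R / d%:R) * (n%:R * Num.sqrt P' / 2) * odds_sum d m
    * alpha_star d n m P' v'
  + m%:R / d%:R
  - n%:R * Num.sqrt P' / 2 * odds_diff d m * alpha_star d n m P' v'.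

Definition theta_hat (R : realType) (d n m : nat) (P' v' : R)
    (y : 'rV[R]_d) : 'rV[R]_d :=
  alpha_star d n m P' v' *: y + const_mx (beta_star d n m P' v').

Definition received (T : Type) (R : realType) (d n m : nat) (P' : R)
    (U : 'I_n -> T -> {ffun 'I_d -> bool}) (Zpri : 'I_n -> T -> 'rV[R]_d)
    (Z : T -> 'rV[R]_d) (t : T) : 'rV[R]_d :=
  \sum_(i < n) (encoder m P' (U i t) + Zpri i t) + Z t.

(* Variance of the local noise, for s channel uses and channel noise
   variance v0. *)
Definition sigma_pri2 (R : realType) (s n : nat) (P v0 eps : R) : R :=
  Num.max ((s%:R * P - 2 * eps * v0) / (2 * eps * n%:R + s%:R)) 0.

(* Worst-case error when the scheme is tuned to the reduced power P - vpri and
   to the total noise variance v0 + n vpri; [Pr theta] is the law of all the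
   random sources under the parameter theta. *)
Definition R_robust (disp : measure_display) (T : measurableType disp)
    (R : realType) (d n m : nat) (P v0 vpri : R)
    (Pr : 'rV[R]_d -> probability T R)
    (U : 'I_n -> T -> {ffun 'I_d -> bool}) (Zpri : 'I_n -> T -> 'rV[R]_d)
    (Z : T -> 'rV[R]_d) : \bar R :=
  ereal_sup [set 'E_(Pr theta)[fun t =>
      sqnorm2 (theta_hat n m (P - vpri) (v0 + n%:R * vpri)
                 (received m (P - vpri) U Zpri Z t) - theta)]%E
    | theta in sparse_params d m].

(* Main.v *)
(* The affine estimate of theta_j has mean g theta_j + (1 - g) m/d for a gain g,
   so its bias is (1 - g) (m/d - theta_j), and its variance is
   g^2/n theta_j (1 - theta_j) + alpha^2 v'. Summing over j, the risk is
   W - (1 - g)^2 (1 - 2m/d) (m - sum_j theta_j)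
     - ((1 - g)^2 - g^2/n) sum_j (theta_j - theta_j^2).
   When (1 - g)^2 >= g^2/n, both subtracted terms are nonnegative on Theta and
   vanish at a 0/1 vector with m ones, so the supremum W is attained; the tuning
   makes (1 - g)^2 = g^2/n at low noise, and v' >= n^(3/2) P' gives the
   inequality at high noise. The choice of the local noise enters only through
   v'/P' = d/(2 eps). *)
From mathcomp Require Import all_boot all_order all_algebra.
From mathcomp Require Import all_classical all_reals all_analysis.
From mathcomp Require Import measurable_realfun ring lra.
Require Import Defs.

Set Implicit Arguments.
Unset Strict Implicit.
Unset Printing Implicit Defensive.

Import Order.TTheory GRing.Theory Num.Theory.
Import numFieldNormedType.Exports.

Local Open Scope classical_set_scope.
Local Open Scope ring_scope.

(** * Moments of the normal law *)

(** The Radon-Nikodym derivative of [normal_prob] and the density have the same integral over every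
    measurable set, so they agree almost everywhere. *)
Lemma ge0_integral_normal_prob (R : realType) (s : R) (f : R -> R) :
  measurable_fun [set: R] f -> (forall x, 0 <= f x) ->
  (\int[normal_prob 0 s]_x (f x)%:E =
   \int[lebesgue_measure]_x (f x * normal_pdf 0 s x)%:E)%E.
Proof.
move=> mf f0.
have dom := normal_prob_dominates (0 : R) s.
have mpdf : measurable_fun [set: R] (EFin \o normal_pdf 0 s).
  by apply/measurable_EFinP; exact: measurable_normal_pdf.
have mf' : measurable_fun [set: R] (EFin \o f) by exact/measurable_EFinP.
under [RHS]eq_integral do rewrite EFinM.
have mRN := measurable_int _ (Radon_Nikodym_SigmaFinite.f_integrable dom).
rewrite -(Radon_Nikodym_SigmaFinite.change_of_variables dom)//.
apply: ae_eq_integral => //; [exact: emeasurable_funM|exact: emeasurable_funM|].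
apply: ae_eqe_mul2l; apply: integral_ae_eq => //.
- exact: Radon_Nikodym_SigmaFinite.f_integrable.
- by move=> E _ mE; rewrite -Radon_Nikodym_SigmaFinite.f_integral.
Qed.

(** Completing the square: t x - x^2/(2 s^2) = t^2 s^2/2 - (x - t s^2)^2/(2 s^2). The moment
    generating function is thus a constant times the mass of a shifted normal density. *)
Lemma expR_mul_normal_pdf (R : realType) (s t x : R) : s != 0 ->
  expR (t * x) * normal_pdf 0 s x =
  expR (t ^+ 2 * s ^+ 2 / 2) * normal_pdf (t * s ^+ 2) s x.
Proof.
move=> s0; rewrite !normal_pdfE// /normal_fun.
rewrite mulrCA [RHS]mulrCA; congr (_ * _); rewrite -!expRD; congr expR.
rewrite subr0 -mulr_natr; field.
by rewrite s0.
Qed.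

Lemma normal_mgf (R : realType) (s t : R) : s != 0 ->
  (\int[normal_prob 0 s]_x (expR (t * x))%:E =
   (expR (t ^+ 2 * s ^+ 2 / 2))%:E)%E.
Proof.
move=> s0; rewrite ge0_integral_normal_prob//; last first.
  by apply: measurableT_comp => //; exact: measurable_funM.
under eq_integral do rewrite expR_mul_normal_pdf// EFinM.
rewrite ge0_integralZl//.
- by rewrite integral_normal_pdf mule1.
- by apply/measurable_EFinP; exact: measurable_normal_pdf.
- by move=> x _; rewrite lee_fin normal_pdf_ge0.
Qed.

(** Stands in for the limit t -> 0: the choice t = e / (K + e) is at most 1 and makes the error t K
    at most e. *)
Lemma ler_linear_error (R : realType) (x y K : R) : 0 <= K ->
  (forall t, 0 < t <= 1 -> x <= y + t * K) -> x <= y.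
Proof.
move=> K0 xyK; apply/ler_addgt0Pr => e e0.
have Ke : 0 < K + e by rewrite ltr_wpDl.
apply: (le_trans (xyK (e / (K + e)) _)).
  by rewrite divr_gt0//= ler_pdivrMr// mul1r lerDr.
rewrite lerD2l -mulrA ler_piMr ?(ltW e0)//.
by rewrite mulrC ler_pdivrMr// mul1r lerDl ltW.
Qed.

Lemma expR_sub1_le (R : realType) (y : R) : expR y - 1 <= y * expR y.
Proof.
have h := expR_ge1Dx (- y).
have : (1 - y) * expR y <= expR (- y) * expR y by rewrite ler_wpM2r ?expR_ge0.
by rewrite expRN mulVf ?gt_eqF ?expR_gt0// => ?; lra.
Qed.

Lemma expR_oppr_ge (R : realType) (a : R) : 0 <= a ->
  2 * a <= expR a - expR (- a).
Proof.
move=> a0; pose f (x : R) := expR x - expR (- x) - 2 * x.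
have df (x : R) : is_derive x 1 f (expR x + expR (- x) - 2).
  apply: is_derive_eq; rewrite /GRing.scale/=; ring.
have : f 0 <= f a.
  apply: (@ger0_derive1_ndecry R f 0) => //.
  - move=> x _; rewrite derive1E derive_val.
    (* The derivative equals exp(-x) (exp(x) - 1)^2, hence is nonnegative. *)
    have h : expR x * expR (- x) = 1 by exact: expRxMexpNx_1.
    have := sqr_ge0 (expR x - 1); have := expR_gt0 x; have := expR_gt0 (- x).
    nra.
  - by apply: derivable_within_continuous => x _; exact: ex_derive.
by rewrite /f oppr0 subrr mulr0 subr0 subr_ge0.
Qed.

(** The middle term is the square of exp(a) - exp(-a) with a = y/2. For y >= 0 this difference lies
    between 2a and 2a exp(a), and squaring gives both bounds. *)
Lemma cosh_bounds (R : realType) (y : R) :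
  y ^+ 2 <= expR y + expR (- y) - 2 <= y ^+ 2 * expR `|y|.
Proof.
wlog y0 : y / 0 <= y => [hw|].
  have [/hw//|/ltW yn] := leP 0 y.
  have := hw (- y); rewrite oppr_ge0 => /(_ yn).
  by rewrite sqrrN opprK normrN [expR (- y) + _]addrC.
rewrite ger0_norm//; set a := y / 2.
have a0 : 0 <= a by rewrite divr_ge0.
have ya : y = a + a by rewrite -splitr.
rewrite ya opprD !expRD.
have h : expR a * expR (- a) = 1 by exact: expRxMexpNx_1.
have -> : expR a * expR a + expR (- a) * expR (- a) - 2 =
    (expR a - expR (- a)) ^+ 2.
  have -> : (expR a - expR (- a)) ^+ 2 =
      expR a * expR a + expR (- a) * expR (- a) - 2 * (expR a * expR (- a)).
    by ring.
  by rewrite h mulr1.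
have -> : (a + a) ^+ 2 * (expR a * expR a) = (2 * a * expR a) ^+ 2 by ring.
have l := expR_oppr_ge a0.
(* Multiply 1 - 2a <= exp(-2a) by exp(a). *)
have u : expR a - expR (- a) <= 2 * a * expR a.
  have := expR_ge1Dx (- (a + a)); rewrite opprD expRD => e.
  have := ler_wpM2r (expR_ge0 a) e.
  by rewrite mulrAC -mulrA h mulr1 => ?; lra.
have D0 : 0 <= expR a - expR (- a) by rewrite (le_trans _ l)// mulr_ge0.
rewrite (_ : a + a = 2 * a); last by ring.
by rewrite !ler_sqr ?nnegrE ?l ?u// ?mulr_ge0 ?expR_ge0.
Qed.

Lemma expR_normr_le (R : realType) (y : R) : expR `|y| <= expR y + expR (- y).
Proof.
by case: ger0P => _; rewrite ?lerDl ?lerDr expR_ge0.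
Qed.

Lemma Lfun2_sqr_integrable d (T : measurableType d) (R : realType)
    (P : probability T R) (X : T -> R) :
  measurable_fun [set: T] X ->
  P.-integrable [set: T] (EFin \o (fun w => X w ^+ 2)) -> X \in Lfun P 2%:E.
Proof.
move=> mX iX; rewrite inE; apply/andP; split; rewrite inE//=.
rewrite /finite_norm unlock /Lnorm poweR_lty//.
under eq_integral do rewrite /= powR_mulrn// real_normK ?num_real//.
exact: integrable_lty.
Qed.

(* The noise variables enter only through their moment generating function
   exp(t^2 v / 2), which covers the degenerate case v = 0 as well; comparing
   exponentials with polynomials as t tends to 0 yields the first two moments. *)
Section gaussian_moments.
Context d (T : measurableType d) (R : realType) (P : probability T R).
Variables (X : T -> R) (v : R).
Hypothesis mX : measurable_fun [set: T] X.
Hypothesis v0 : 0 <= v.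
Hypothesis mgf : forall t,
  (\int[P]_w (expR (t * X w))%:E = (expR (t ^+ 2 * v / 2))%:E)%E.

Let mexp t : measurable_fun [set: T] (fun w => expR (t * X w)).
Proof. by apply: measurableT_comp => //; exact: measurable_funM. Qed.

Let iexp t : P.-integrable [set: T] (EFin \o (fun w => expR (t * X w))).
Proof.
apply/integrableP; split; first exact/measurable_EFinP.
under eq_integral do rewrite /= ger0_norm ?expR_ge0//.
by rewrite mgf ltry.
Qed.

Let Rmgf t : \int[P]_w expR (t * X w) = expR (t ^+ 2 * v / 2).
Proof. by rewrite /Rintegral mgf. Qed.

(** The lower bound of [cosh_bounds] dominates X^2 by exp(X) + exp(-X), integrable by the generating
    function at 1 and -1. *)
Let isqr : P.-integrable [set: T] (EFin \o (fun w => X w ^+ 2)).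
Proof.
have : P.-integrable [set: T]
    ((EFin \o (fun w => expR (1 * X w))) \+
     (EFin \o (fun w => expR (-1 * X w))))%E.
  by apply: integrableD.
apply: le_integrable => //.
  by apply/measurable_EFinP; exact: measurable_funX.
move=> w _ /=; rewrite lee_fin ger0_norm ?sqr_ge0// mul1r mulN1r.
rewrite ger0_norm ?addr_ge0 ?expR_ge0//.
by have /andP[+ _] := cosh_bounds (X w); lra.
Qed.

Lemma gaussian_Lfun2 : X \in Lfun P 2%:E.
Proof. exact: Lfun2_sqr_integrable. Qed.

Let iX : P.-integrable [set: T] (EFin \o X).
Proof.
by apply/Lfun1_integrable; apply: Lfun_subset12 gaussian_Lfun2;
  exact: fin_num_measure.
Qed.

Let Rcst (r : R) : \int[P]_w r = r.
Proof. by rewrite Rintegral_cst//= probability_setT mulr1. Qed.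

Let icst (r : R) : P.-integrable [set: T] (EFin \o (fun=> r)).
Proof. exact: finite_measure_integrable_cst. Qed.

Let iZ (k : R) (f : T -> R) : P.-integrable [set: T] (EFin \o f) ->
  P.-integrable [set: T] (EFin \o (fun w => k * f w)).
Proof.
by move=> fi; apply: eq_integrable (integrableZl measurableT k fi).
Qed.

(** For |t| <= 1 the factor exp(t^2 v/2) is at most exp(v/2), so the error is a fixed multiple of
    t^2. *)
Let mgf_error (t : R) : `|t| <= 1 ->
  expR (t ^+ 2 * v / 2) - 1 <= t ^+ 2 * v / 2 * expR (v / 2).
Proof.
move=> t1; apply: (le_trans (expR_sub1_le _)).
apply: ler_wpM2l; first by rewrite divr_ge0// mulr_ge0// sqr_ge0.
rewrite ler_expR; apply: ler_wpM2r; first by rewrite invr_ge0.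
rewrite -[leRHS]mul1r; apply: ler_wpM2r => //.
by rewrite -real_normK ?num_real// expr_le1.
Qed.

(** Integrate 1 + t X <= exp(t X). Both signs of t are allowed, which later bounds the mean from
    both sides. *)
Let mean_le (t : R) : `|t| <= 1 ->
  t * \int[P]_w X w <= t ^+ 2 * (v / 2 * expR (v / 2)).
Proof.
move=> t1; rewrite -RintegralZl// mulrA.
have itX : P.-integrable [set: T] (EFin \o (fun w => t * X w)).
  exact: iZ.
have : \int[P]_w (1 + t * X w) <= \int[P]_w expR (t * X w).
  apply: le_Rintegral => //; last by move=> w _; exact: expR_ge1Dx.
  exact: (integrableD _ (icst 1) itX).
rewrite RintegralD// Rcst Rmgf.
by have := mgf_error t1; rewrite -(mulrA (t ^+ 2)); lra.
Qed.

Lemma gaussian_mean : ('E_P[X] = 0)%E.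
Proof.
have K0 : 0 <= v / 2 * expR (v / 2) by rewrite mulr_ge0 ?divr_ge0 ?expR_ge0.
suff m0 : \int[P]_w X w = 0.
  by rewrite unlock -[LHS]fineK ?integrable_fin_num// -[fine _]/(Rintegral _ _ _) m0.
(* Dividing [mean_le] by t > 0 bounds the mean above by a multiple of t; the same bound at -t bounds
   it below. *)
apply/eqP; rewrite eq_le; apply/andP.
split; apply: (ler_linear_error K0) => t /andP[t0 t1].
- have := mean_le (t := t); rewrite (ger0_norm (ltW t0)) => /(_ t1).
  by move=> h; rewrite -(ler_pM2l t0) add0r mulrA -expr2.
- have := mean_le (t := - t); rewrite normrN (ger0_norm (ltW t0)) => /(_ t1).
  move=> h; rewrite -(ler_pM2l t0) mulr0 mulrDr mulrA -expr2.
  by move: h; rewrite sqrrN mulNr; lra.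
Qed.

Let icosh t : P.-integrable [set: T]
  (EFin \o (fun w => expR (t * X w) + expR (- (t * X w)) - 2)).
Proof.
have ie := integrableD measurableT (iexp t) (iexp (- t)).
have := integrableB measurableT ie (icst 2).
by apply: eq_integrable => // w _ /=; rewrite mulNr.
Qed.

(** The symmetric combination cancels the odd orders in t; its leading term is t^2 X^2, while the
    right-hand side is t^2 v to leading order. *)
Let Rcosh t : \int[P]_w (expR (t * X w) + expR (- (t * X w)) - 2) =
  2 * (expR (t ^+ 2 * v / 2) - 1).
Proof.
have e : (fun w => expR (- (t * X w))) = (fun w => expR (- t * X w)).
  by apply/funext => w; rewrite mulNr.
have i' : P.-integrable [set: T] (EFin \o (fun w => expR (- (t * X w)))).
  by rewrite e.
rewrite RintegralB//; last exact: (integrableD _ (iexp t) i').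
rewrite RintegralD// e !Rmgf Rcst sqrrN; ring.
Qed.

Lemma gaussian_second_moment : ('E_P[X ^+ 2] = v%:E)%E.
Proof.
suff m2 : \int[P]_w (X w ^+ 2) = v.
  rewrite unlock -[LHS]fineK ?integrable_fin_num//.
  by rewrite -[fine _]/(Rintegral _ _ (X ^+ 2)) m2.
apply/eqP; rewrite eq_le; apply/andP; split.
(* Upper bound: t^2 X^2 lies below the symmetric combination, whose mean exceeds t^2 v by at most
   t^4 times this constant, and t^2 <= t. *)
- apply: (@ler_linear_error _ _ _ (v ^+ 2 / 2 * expR (v / 2))).
    by rewrite mulr_ge0 ?divr_ge0 ?sqr_ge0 ?expR_ge0.
  move=> t /andP[t0 t1].
  have t2 : 0 < t ^+ 2 by rewrite exprn_gt0.
  have nt : `|t| <= 1 by rewrite ger0_norm// ltW.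
  have : t ^+ 2 * \int[P]_w (X w ^+ 2) <= 2 * (expR (t ^+ 2 * v / 2) - 1).
    rewrite -RintegralZl// -Rcosh; apply: le_Rintegral => //.
      exact: iZ.
    by move=> w _; have /andP[+ _] := cosh_bounds (t * X w); rewrite exprMn.
  move=> h; rewrite -(ler_pM2l t2); apply: (le_trans h).
  set x := t ^+ 2 * v / 2.
  have x0 : 0 <= x by rewrite divr_ge0// mulr_ge0// ltW.
  (* A second-order estimate: [expR_sub1_le] leaves x exp(x), and [mgf_error] bounds this last
     exponential in turn. *)
  have h1 : expR x - 1 <= x * (1 + x * expR (v / 2)).
    apply: (le_trans (expR_sub1_le _)); rewrite ler_wpM2l//.
    by have := mgf_error nt; rewrite -/x; lra.
  apply: (@le_trans _ _ (2 * (x * (1 + x * expR (v / 2))))).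
    by rewrite ler_wpM2l.
  rewrite [leLHS](_ : _ =
      t ^+ 2 * (v + t * t * (v ^+ 2 / 2 * expR (v / 2)))); last first.
    by rewrite /x; field.
  rewrite ler_wpM2l ?(ltW t2)// lerD2l ler_wpM2r//.
    by rewrite mulr_ge0 ?divr_ge0 ?sqr_ge0 ?expR_ge0.
  by rewrite ler_piMr// ltW.
(* Lower bound: with a = |X|, a^2 exp(t a) <= a^2 + t a^3 exp(a) <= a^2 + 6 t exp(2a), and exp(2a)
   <= exp(2X) + exp(-2X). The mean of this last error is the constant. *)
- apply: (@ler_linear_error _ _ _
    (\int[P]_w (6 * (expR (2 * X w) + expR (- 2 * X w))))).
    by apply: Rintegral_ge0 => w _; rewrite mulr_ge0 ?addr_ge0 ?expR_ge0.
  move=> t /andP[t0 t1].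
  have t2 : 0 < t ^+ 2 by rewrite exprn_gt0.
  have iW : P.-integrable [set: T]
      (EFin \o (fun w => 6 * (expR (2 * X w) + expR (- 2 * X w)))).
    by apply: iZ; exact: (integrableD _ (iexp 2) (iexp (- 2))).
  have itW : P.-integrable [set: T]
      (EFin \o (fun w => t * (6 * (expR (2 * X w) + expR (- 2 * X w))))).
    exact: iZ.
  have iS : P.-integrable [set: T]
      (EFin \o (fun w => X w ^+ 2 + t * (6 * (expR (2 * X w) + expR (- 2 * X w))))).
    exact: (integrableD _ isqr itW).
  rewrite -RintegralZl// -RintegralD// -(ler_pM2l t2) -RintegralZl//.
  apply: (@le_trans _ _ (2 * (expR (t ^+ 2 * v / 2) - 1))).
    by have := expR_ge1Dx (t ^+ 2 * v / 2); lra.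
  rewrite -Rcosh; apply: le_Rintegral => //; first exact: iZ.
  move=> w _; have /andP[_ h] := cosh_bounds (t * X w); apply: (le_trans h).
  rewrite exprMn -mulrA ler_wpM2l ?(ltW t2)//.
  set a := `|X w|; have a0 : 0 <= a by exact: normr_ge0.
  rewrite -(real_normK (num_real (X w))) -/a normrM (ger0_norm (ltW t0)) -/a.
  have h1 : expR (t * a) <= 1 + t * a * expR a.
    have := expR_sub1_le (t * a).
    have : t * a * expR (t * a) <= t * a * expR a.
      by rewrite ler_wpM2l ?mulr_ge0 ?(ltW t0)// ler_expR ler_piMl.
    lra.
  apply: (le_trans (ler_wpM2l (sqr_ge0 a) h1)).
  rewrite mulrDr mulr1 lerD2l [leLHS](_ : _ = t * (a ^+ 3 * expR a)); last by ring.
  rewrite ler_wpM2l ?(ltW t0)//.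
  (* The cubic Taylor term a^3/3! of the exponential; index 2 in [expR_ge1Dxn] yields exponent 3. *)
  have a3 : a ^+ 3 <= 6 * expR a.
    by have := @expR_ge1Dxn R a 2 a0; rewrite (_ : 3`! = 6)//; lra.
  apply: (le_trans (ler_wpM2r (expR_ge0 a) a3)).
  rewrite -mulrA -expRD ler_wpM2l//.
  have := expR_normr_le (2 * X w); rewrite normrM ger0_norm// -/a.
  by rewrite mulNr mulr2n mulrDl mul1r.
Qed.

End gaussian_moments.

(** * Sums of pairwise uncorrelated variables *)

Section independence.
Context d (T : measurableType d) (R : realType) (P : probability T R).

(** The joint law agrees with the product of the marginals on rectangles, hence everywhere; Fubini
    then factors the integral of x y. *)
Lemma indep_expectationM (X Y : T -> R) :
  X \in Lfun P 2%:E -> Y \in Lfun P 2%:E ->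
  (forall A B : set R, measurable A -> measurable B ->
    P (X @^-1` A `&` Y @^-1` B) = P (X @^-1` A) * P (Y @^-1` B))%E ->
  ('E_P[X * Y] = 'E_P[X] * 'E_P[Y])%E.
Proof.
move=> X2 Y2 XY.
have Pfin : P [set: T] \is a fin_num by exact: fin_num_measure.
have /Lfun1_integrable iX := Lfun_subset12 Pfin X2.
have /Lfun1_integrable iY := Lfun_subset12 Pfin Y2.
have /Lfun1_integrable iXY := Lfun2_mul_Lfun1 X2 Y2.
have mX : measurable_fun [set: T] X by exact/measurable_EFinP/(measurable_int P).
have mY : measurable_fun [set: T] Y by exact/measurable_EFinP/(measurable_int P).
have mXY : measurable_fun [set: T] (fun w => (X w, Y w)).
  exact: measurable_fun_pair.
pose X' : {mfun T >-> R} := mfun_Sub (mem_set mX).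
pose Y' : {mfun T >-> R} := mfun_Sub (mem_set mY).
pose XY' : {mfun T >-> (R * R)%type} :=
  mfun_Sub (mem_set mXY).
pose f (z : R * R) : \bar R := (z.1 * z.2)%:E.
have mf : measurable_fun setT f.
  by apply/measurable_EFinP; apply: measurable_funM.
have jointE A : measurable A ->
    (distribution P X' \x distribution P Y')%E A = distribution P XY' A.
  by apply: product_measure_unique => B C mB mC; exact: XY.
have prodE g : (\int[distribution P X' \x distribution P Y']_z g z =
    \int[distribution P XY']_z g z)%E.
  by apply: eq_measure_integral => A mA _; exact: jointE.
have if_ : (distribution P X' \x distribution P Y')%E.-integrable setT f.
  apply/integrableP; split=> //; rewrite prodE.
  have /integrableP[_] : (distribution P XY').-integrable setT f.
    exact: (integrable_pushforward (phi := XY')).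
  by [].
rewrite unlock.
transitivity (\int[distribution P XY']_z f z)%E.
  by rewrite integral_distribution.
rewrite -prodE -integral12_prod_meas1// /fubini_F.
under eq_integral => x _.
  rewrite /f /=; under eq_integral do rewrite EFinM.
  rewrite integralZl//; last exact: (integrable_pushforward (phi := Y')).
  rewrite (@integral_distribution _ _ _ _ _ P Y' EFin)//.
  rewrite -(fineK (integrable_fin_num measurableT iY)).
  over.
rewrite integralZr//; last exact: (integrable_pushforward (phi := X')).
rewrite (@integral_distribution _ _ _ _ _ P X' EFin)//.
by rewrite (fineK (integrable_fin_num measurableT iY)).
Qed.

Lemma variance_sum_uncorrelated (I : finType) (X : I -> T -> R) :
  (forall k, X k \in Lfun P 2%:E) ->
  (forall k l, k != l -> covariance P (X k) (X l) = 0%E) ->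
  (variance P (\sum_k X k)%R = \sum_k variance P (X k))%E.
Proof.
(* Passing to a duplicate-free list allows induction: the head differs from every later index, so
   its covariance with the remaining sum vanishes. *)
move=> X2 X0; rewrite -!(big_enum _ _ _ (fun k => X k)).
rewrite -!(big_enum _ _ _ (fun k => variance P (X k))) /=.
have L2 (s : seq I) : (\sum_(k <- s) X k)%R \in Lfun P 2%:E.
  by rewrite rpred_sum ?lee1n// => p1 k _; exact: X2.
elim: (enum I) (enum_uniq I) => [_|k s IH /= /andP[ks us]].
  by rewrite !big_nil variance_cst.
rewrite !big_cons varianceD// IH//.
suff -> : covariance P (X k) (\sum_(l <- s) X l)%R = 0%E.
  by rewrite mule0 adde0.
elim: s ks {us IH} => [_|l s IH]; first by rewrite big_nil covariance_cst_r.
rewrite inE negb_or => /andP[kl ks].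
by rewrite big_cons covarianceDr// IH// X0// adde0.
Qed.

(** The bias-variance decomposition E[Y^2] = Var(Y) + E[Y]^2 for Y = a X + b. *)
Lemma expectation_sqr_affine (X : T -> R) (a b m v : R) :
  X \in Lfun P 2%:E -> ('E_P[X] = m%:E)%E -> variance P X = v%:E ->
  ('E_P[(fun w => (a * X w + b) ^+ 2)%R] = (a ^+ 2 * v + (a * m + b) ^+ 2)%:E)%E.
Proof.
move=> X2 EX VX.
have X1 := Lfun_subset12 (fin_num_measure P _ measurableT) X2.
pose Y : T -> R := (a \o* X \+ cst b)%R.
have Y2 : Y \in Lfun P 2%:E.
  by rewrite rpredD ?lee1n//= ?Lfun_cst// Lfun_scale// ler1n.
have EY : ('E_P[Y] = (a * m + b)%:E)%E.
  rewrite expectationD ?Lfun_cst ?Lfun_scale// expectationZl// EX.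
  by rewrite expectation_cst.
have := varianceE Y2.
rewrite varianceD_cst_r ?Lfun_scale ?ler1n// varianceZ// VX EY => VY.
rewrite (_ : (fun w => _) = Y ^+ 2)%R; last first.
  by apply/funext => w; rewrite /Y /= mulrC.
have fE : ('E_P[Y ^+ 2] \is a fin_num)%E.
  by rewrite expectation_fin_num// expr2 Lfun2_mul_Lfun1.
move: VY; rewrite -(fineK fE) -EFin_expe -EFinB => -[] /esym/eqP.
by rewrite subr_eq => /eqP ->.
Qed.
End independence.

(** * The received signal *)

Lemma has_isotropic_normal_law_mgf d (T : measurableType d) (R : realType)
    (P : probability T R) (n : nat) (v : R) (X : T -> 'rV[R]_n) (j : 'I_n) :
  0 <= v -> has_isotropic_normal_law P v X ->
  measurable_fun [set: T] (fun w => X w 0 j) /\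
  forall t, (\int[P]_w (expR (t * X w 0 j))%:E = (expR (t ^+ 2 * v / 2))%:E)%E.
Proof.
move=> v0 [mX lawX].
have mXj : measurable_fun [set: T] (fun w => X w 0 j).
  by move=> _ B mB; rewrite setTI; apply: mX; exists j, B.
split=> // t.
have lawXj (B : set R) : measurable B ->
    P ((fun w => X w 0 j) @^-1` B) = centered_normal v B.
  (* The marginal law of coordinate j comes from the box that is [B] in direction j and the whole
     line elsewhere. *)
  move=> mB; pose C i : set R := if i == j then B else setT.
  have mC i : measurable (C i) by rewrite /C; case: ifP.
  have Cj : C j = B by rewrite /C eqxx.
  have := lawX C mC; rewrite (bigD1 j)//= Cj big1 ?mule1 => [<-|i ij].
    congr (P _); apply/seteqP; split=> w /= hw => [i|].
      by rewrite /C; case: eqP => // ->.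
    by have := hw j; rewrite Cj.
  rewrite /C (negbTE ij) /centered_normal; case: ifP => _; last exact: probability_setT.
  by rewrite diracT.
have mXj' : @measurable_fun _ _ T (measurableTypeR R) setT (fun w => X w 0 j).
  exact: mXj.
pose X' : {mfun T >-> measurableTypeR R} :=
  @mfun_Sub _ _ T (measurableTypeR R) _ (mem_set mXj').
have mE : @measurable_fun _ _ (measurableTypeR R) R setT (fun x : R => expR (t * x)).
  by apply: measurableT_comp => //; exact: measurable_funM.
transitivity (\int[distribution P X']_x (expR (t * x))%:E)%E.
  by rewrite ge0_integral_distribution//; exact/measurable_EFinP.
(* For v = 0 the law is the point mass at 0, and both sides are 1. *)
have [vE|vN0] := eqVneq v 0.
  rewrite (@eq_measure_integral _ _ _ _ (\d_(0 : measurableTypeR R))); last first.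
    by move=> B mB _; rewrite -[LHS]/(P _) lawXj// /centered_normal vE eqxx.
  rewrite integral_dirac//; last exact/measurable_EFinP.
  by rewrite diracT mul1e mulr0 vE mulr0 mul0r.
rewrite (@eq_measure_integral _ _ _ _ (normal_prob 0 (Num.sqrt v))); last first.
  by move=> B mB _; rewrite -[LHS]/(P _) lawXj// /centered_normal (negbTE vN0).
by rewrite normal_mgf ?sqrtr_eq0 -?ltNge ?lt0r ?vN0// sqr_sqrtr.
Qed.

(** The constraint on bit j is absorbed into factor j by giving it the value 0 at false. The sum of
    products then becomes a product of sums, all equal to 1 except the j-th. *)
Lemma bernoulli_product_marginal (R : realType) (d : nat) (theta : 'rV[R]_d)
    (j : 'I_d) :
  \sum_(u : {ffun 'I_d -> bool} | u j) bernoulli_product_pmf theta u = theta 0 j.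
Proof.
pose F (k : 'I_d) (b : bool) : R :=
  if k == j then (if b then theta 0 j else 0) else bernoulli_pmf (theta 0 k) b.
transitivity (\sum_(u : {ffun 'I_d -> bool}) \prod_k F k (u k)).
  rewrite big_mkcond; apply: eq_bigr => u _.
  rewrite /bernoulli_product_pmf (bigD1 j)//= [RHS](bigD1 j)//= {1}/F eqxx.
  case: (u j) => /=; last by rewrite mul0r.
  by congr (_ * _); apply: eq_bigr => k /negbTE kj; rewrite /F kj.
rewrite -bigA_distr_bigA (bigD1 j)//= [X in _ * X]big1 ?mulr1 => [|k /negbTE kj].
  by rewrite big_bool /F eqxx /= addr0.
by rewrite big_bool /F kj /bernoulli_pmf /= addrC subrK.
Qed.

Lemma big_option (R : Type) (idx : R) (op : Monoid.com_law idx) (I : finType)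
    (F : option I -> R) :
  \big[op/idx]_k F k = op (F None) (\big[op/idx]_i F (Some i)).
Proof.
rewrite (bigD1 None)//=; congr (op _ _).
by rewrite (reindex_omap (@Some I) id) => [|[]//]; apply: eq_bigl => i; rewrite eqxx.
Qed.

Section received_signal.
Context (disp : measure_display) (T : measurableType disp) (R : realType).
Variables (P : probability T R) (d n m : nat) (theta : 'rV[R]_d) (vpri v0 P' : R).
Variables (U : 'I_n -> T -> {ffun 'I_d -> bool}).
Variables (Zpri : 'I_n -> T -> 'rV[R]_d) (Z : T -> 'rV[R]_d).
Hypotheses (vpri0 : 0 <= vpri) (v00 : 0 <= v0).
Hypothesis model : bernoulli_channel_model P theta vpri v0 U Zpri Z.
Variable j : 'I_d.

(** The encoder is affine in the bit: it sends b to [amplitude] times b, minus [offset]. *)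
Definition amplitude : R :=
  Num.sqrt ((d%:R - m%:R) / m%:R * P') + Num.sqrt (m%:R / (d%:R - m%:R) * P').
Definition offset : R := Num.sqrt (m%:R / (d%:R - m%:R) * P').

(** The index type is that of [source_events], so one received coordinate is a single sum over the
    independent sources. *)
Definition source (k : 'I_n + option 'I_n) (t : T) : R :=
  match k with
  | inl i => encoder m P' (U i t) 0 j
  | inr (Some i) => Zpri i t 0 j
  | inr None => Z t 0 j
  end.

Let bit (i : 'I_n) : set T := [set t | U i t j].

(** The model speaks of single data vectors only; this finite disjoint union carries measurability
    and probability over to one bit. *)
Let bit_bigcup i :
  bit i = \bigcup_(u in [set` (fun u : {ffun 'I_d -> bool} => u j)])
            (U i @^-1` [set u]).
Proof.
rewrite /bit; apply/seteqP; split=> t /=; first by move=> ut; exists (U i t).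
by move=> [u uj ->].
Qed.

Let measurable_bit i : measurable (bit i).
Proof.
rewrite bit_bigcup; apply: fin_bigcup_measurable => // u _.
exact: (model_data_measurable model).
Qed.

Let bit_prob i : P (bit i) = (theta 0 j)%:E.
Proof.
rewrite bit_bigcup measure_fin_bigcup//; last 2 first.
- by move=> u v _ _ [t [/= tu tv]]; rewrite -tu -tv.
- by move=> u _; exact: (model_data_measurable model).
rewrite -(@bigfs _ _ _ _ (index_enum _)) ?index_enum_uniq//; last first.
  by move=> u _; rewrite mem_index_enum.
rewrite (eq_bigr (fun u => (bernoulli_product_pmf theta u)%:E)); last first.
  by move=> u _; exact: (model_data_law model).
by rewrite sumEFin bernoulli_product_marginal.
Qed.

Let source_bitE i :
  source (inl i) = (amplitude \o* \1_(bit i) \+ cst (- offset))%R.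
Proof.
apply/funext => t; rewrite /source /encoder mxE /= indicE /amplitude /offset.
have [tb|tb] := boolP (U i t j).
  by rewrite mem_set//= mul1r addrK.
by rewrite memNset ?mul0r ?add0r//; exact/negP.
Qed.

Let indic_Lfun2 i : (\1_(bit i) : T -> R) \in Lfun P 2%:E.
Proof.
have mI : measurable_fun [set: T] (\1_(bit i) : T -> R) by exact: measurable_indic.
apply: Lfun2_sqr_integrable => //.
have : P.-integrable [set: T] (EFin \o \1_(bit i)).
  by apply: integrable_indic => //; exact: fin_num_measure.
apply: eq_integrable => // t _ /=; congr EFin.
by rewrite indicE; case: (_ \in _); rewrite ?expr1n ?expr0n.
Qed.

Let P2 : 1 <= 2 :> R. Proof. by rewrite ler1n. Qed.

Let sub12 (f : T -> R) : f \in Lfun P 2%:E -> f \in Lfun P 1.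
Proof. by apply: Lfun_subset12; exact: fin_num_measure. Qed.

Lemma source_Lfun2 k : source k \in Lfun P 2%:E.
Proof.
case: k => [i|[i|]].
- by rewrite source_bitE rpredD ?lee1n//= ?Lfun_cst// Lfun_scale.
- have [mZ gZ] := has_isotropic_normal_law_mgf j vpri0 (model_local_noise_law model i).
  exact: gaussian_Lfun2 gZ.
- have [mZ gZ] := has_isotropic_normal_law_mgf j v00 (model_channel_noise_law model).
  exact: gaussian_Lfun2 gZ.
Qed.

Definition source_mean (k : 'I_n + option 'I_n) : R :=
  if k is inl _ then amplitude * theta 0 j - offset else 0.

Definition source_var (k : 'I_n + option 'I_n) : R :=
  match k with
  | inl _ => amplitude ^+ 2 * (theta 0 j * (1 - theta 0 j))
  | inr (Some _) => vpri
  | inr None => v0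
  end.

Let centered_variance (X : T -> R) (v : R) : X \in Lfun P 2%:E ->
  ('E_P[X] = 0 -> 'E_P[X ^+ 2] = v%:E -> variance P X = v%:E)%E.
Proof. by move=> X2 E0 E2; rewrite varianceE// E0 E2 expe2 mule0 sube0. Qed.

Lemma source_moments k :
  ('E_P[source k] = (source_mean k)%:E)%E /\
  (variance P (source k) = (source_var k)%:E)%E.
Proof.
case: k => [i|[i|]].
- rewrite source_bitE; split.
    rewrite expectationD ?Lfun_cst ?Lfun_scale ?sub12//.
    by rewrite expectationZl ?sub12// expectation_indic// bit_prob expectation_cst.
  rewrite varianceD_cst_r ?Lfun_scale// varianceZ// varianceE//.
  rewrite (_ : \1_(bit i) ^+ 2 = \1_(bit i) :> (T -> R)); last first.
    apply/funext => t; rewrite expr2 /= -[LHS]/(\1_(bit i) t * \1_(bit i) t).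
    by rewrite !indicE -natrM mulnb andbb.
  rewrite expectation_indic// bit_prob -EFin_expe -EFinB -EFinM.
  by congr EFin; rewrite /source_var; ring.
- have [mZ gZ] := has_isotropic_normal_law_mgf j vpri0 (model_local_noise_law model i).
  have m0 := gaussian_mean mZ vpri0 gZ.
  split=> //; apply: centered_variance => //; first exact: (source_Lfun2 (inr (Some i))).
  exact: (gaussian_second_moment mZ vpri0 gZ).
- have [mZ gZ] := has_isotropic_normal_law_mgf j v00 (model_channel_noise_law model).
  have m0 := gaussian_mean mZ v00 gZ.
  split=> //; apply: centered_variance => //; first exact: (source_Lfun2 (inr None)).
  exact: (gaussian_second_moment mZ v00 gZ).
Qed.

Let source_event k (B : set R) : measurable B ->
  source_events U Zpri Z k (source k @^-1` B).
Proof.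
move=> mB; case: k => [i|[i|]].
- by exists [set u | B (encoder m P' u 0 j)].
- by apply: sub_sigma_algebra; exists j, B.
- by apply: sub_sigma_algebra; exists j, B.
Qed.

Lemma source_uncorrelated k l : k != l -> covariance P (source k) (source l) = 0%E.
Proof.
move=> kl; have k2 := source_Lfun2 k; have l2 := source_Lfun2 l.
rewrite (covarianceE (sub12 k2) (sub12 l2) (Lfun2_mul_Lfun1 k2 l2)).
rewrite indep_expectationM//.
  by rewrite subee// fin_numM// expectation_fin_num// sub12.
move=> A B mA mB.
(* Mutual independence is applied to the pair {k, l} with these two events. *)
pose E i := if i == k then source k @^-1` A else source l @^-1` B.
have Ek : E k = source k @^-1` A by rewrite /E eqxx.
have El : E l = source l @^-1` B by rewrite /E eq_sym (negbTE kl).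
have := model_independent model (J := [set k; l]%SET) (E := E).
rewrite big_setU1 ?inE//= big_set1 Ek El => <-.
- congr (P _); apply/seteqP; split=> t /=.
    by move=> [tA tB] i; rewrite /= !inE => /orP[] /eqP ->; rewrite ?Ek ?El.
  move=> h; split.
    by have := h k; rewrite /= !inE eqxx Ek; apply.
  by have := h l; rewrite /= !inE eqxx orbT El; apply.
- by move=> i; rewrite !inE => /orP[] /eqP ->; rewrite ?Ek ?El; exact: source_event.
Qed.

Lemma received_coordE t :
  received m P' U Zpri Z t 0 j = (\sum_k source k)%R t.
Proof.
rewrite /received mxE summxE fct_sumE big_sumType big_option /=.
under eq_bigr do rewrite mxE.
by rewrite big_split /= -!addrA; congr (_ + _); rewrite addrC.
Qed.

Let sum_source_Lfun2 : (\sum_k source k)%R \in Lfun P 2%:E.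
Proof. by rewrite rpred_sum ?lee1n// => k _; exact: source_Lfun2. Qed.

Lemma measurable_received :
  measurable_fun [set: T] (fun t => received m P' U Zpri Z t 0 j).
Proof.
rewrite (_ : (fun t => _) = (\sum_k source k)%R); last first.
  by apply/funext => t; exact: received_coordE.
by have /andP[/[!inE]] := sum_source_Lfun2.
Qed.

Lemma expectation_sqr_received (a b : R) :
  ('E_P[(fun t => (a * received m P' U Zpri Z t 0 j + b) ^+ 2)%R] =
   (a ^+ 2 * (n%:R * (amplitude ^+ 2 * (theta 0 j * (1 - theta 0 j))) +
              n%:R * vpri + v0)
    + (a * (n%:R * (amplitude * theta 0 j - offset)) + b) ^+ 2)%:E)%E.
Proof.
under [X in ('E_P[X])%E]eq_fun do rewrite received_coordE.
apply: expectation_sqr_affine => //.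
- rewrite -(big_map source xpredT id) expectation_sum; last first.
    by move=> _ /mapP[k _ ->]; exact/sub12/source_Lfun2.
  rewrite big_map; under eq_bigr do rewrite (source_moments _).1.
  rewrite sumEFin big_sumType /= [X in _ + X]big1_eq addr0.
  by rewrite sumr_const card_ord mulr_natl.
- rewrite variance_sum_uncorrelated; [|exact: source_Lfun2|exact: source_uncorrelated].
  under eq_bigr do rewrite (source_moments _).2.
  rewrite sumEFin big_sumType big_option /= !sumr_const card_ord !mulr_natl.
  by congr EFin; rewrite -addrA; congr (_ + _); rewrite addrC.
Qed.

End received_signal.

(** * The worst-case risk *)

Lemma expectation_sum_sqr d (T : measurableType d) (R : realType)
    (P : probability T R) (n : nat) (X : 'I_n -> T -> R) :
  (forall j, measurable_fun [set: T] (X j)) ->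
  ('E_P[(fun t => \sum_j X j t ^+ 2)%R] = \sum_j 'E_P[(fun t => X j t ^+ 2)%R])%E.
Proof.
move=> mX; rewrite unlock; under eq_integral do rewrite -sumEFin.
rewrite ge0_integral_sum// => j.
  by apply/measurable_EFinP; exact: measurable_funX.
by move=> t _; rewrite lee_fin sqr_ge0.
Qed.

Section risk.
Context (R : realType) (d n m : nat).
Hypotheses (n0 : (0 < n)%N) (m0 : (0 < m)%N).
Hypothesis md : 2 * m%:R <= d%:R :> R.

Let D0 : 0 < d%:R :> R.
Proof. by rewrite (lt_le_trans _ md)// mulr_gt0// ltr0n. Qed.
Let M0 : 0 < m%:R :> R. Proof. by rewrite ltr0n. Qed.
Let N0 : 0 < n%:R :> R. Proof. by rewrite ltr0n. Qed.
Let DM0 : 0 < d%:R - m%:R :> R.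
Proof. by have := md; have := M0; lra. Qed.

Lemma odds_sum_gt0 : 0 < odds_sum d m :> R.
Proof. by rewrite /odds_sum addr_gt0// sqrtr_gt0 divr_gt0. Qed.

(** The two square roots are mutually inverse, so the square is (d-m)/m + 2 + m/(d-m). *)
Lemma odds_sum_sqr :
  odds_sum d m ^+ 2 = d%:R ^+ 2 / (m%:R * (d%:R - m%:R)) :> R.
Proof.
rewrite /odds_sum sqrrD !sqr_sqrtr ?divr_ge0 ?(ltW DM0) ?(ltW M0)//.
rewrite -sqrtrM ?divr_ge0 ?(ltW DM0)// mulrA divfK ?gt_eqF// divff ?gt_eqF// sqrtr1.
by field; rewrite !gt_eqF.
Qed.

Lemma amplitudeE (P' : R) : amplitude d m P' = odds_sum d m * Num.sqrt P'.
Proof.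
have DM := ltW DM0; have M := ltW M0.
by rewrite /amplitude 2?(sqrtrM _ (divr_ge0 _ _))// -mulrDl.
Qed.

Lemma offsetE (P' : R) : offset d m P' = Num.sqrt (m%:R / (d%:R - m%:R)) * Num.sqrt P'.
Proof. by rewrite /offset sqrtrM// divr_ge0// ltW. Qed.

(* The bias of the affine estimate at [x] is [(1 - gain) (m/d - x)]: [beta_star]
   makes it vanish at the centre [m/d]. *)
Definition gain (P' v' : R) : R :=
  alpha_star d n m P' v' * (n%:R * (Num.sqrt P' * odds_sum d m)).

Definition coordinate_risk (P' v' x : R) : R :=
  (1 - gain P' v') ^+ 2 * (m%:R / d%:R - x) ^+ 2
  + gain P' v' ^+ 2 / n%:R * (x * (1 - x)) + alpha_star d n m P' v' ^+ 2 * v'.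

Lemma coordinate_riskE (P' v0 vpri x : R) :
  let v' := v0 + n%:R * vpri in
  let al := alpha_star d n m P' v' in
  al ^+ 2 * (n%:R * (amplitude d m P' ^+ 2 * (x * (1 - x))) + n%:R * vpri + v0)
    + (al * (n%:R * (amplitude d m P' * x - offset d m P'))
       + (beta_star d n m P' v' - x)) ^+ 2 =
  coordinate_risk P' v' x.
Proof.
move=> v' al; rewrite /coordinate_risk /gain -/al /beta_star -/al amplitudeE offsetE.
(* Unfolding exposes sqrt(m/(d-m)) + [odds_diff]/2 = [odds_sum]/2, by which the constant terms
   combine into the bias (1 - g) (m/d - x). *)
rewrite /odds_sum /odds_diff /v'.
by field; rewrite !gt_eqF.
Qed.

(** The factor m (d-m)/d is the sum of (m/d - x_j)^2 over a 0/1 vector with m ones, where the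
    Bernoulli variances vanish. *)
Definition worst_case_risk (P' v' : R) : R :=
  m%:R * (d%:R - m%:R) / d%:R * (1 - gain P' v') ^+ 2
  + d%:R * (alpha_star d n m P' v' ^+ 2 * v').

Lemma sum_coordinate_risk (P' v' : R) (x : 'I_d -> R) :
  \sum_j coordinate_risk P' v' (x j) =
  worst_case_risk P' v'
  - (1 - gain P' v') ^+ 2 * (1 - 2 * m%:R / d%:R) * (m%:R - \sum_j x j)
  - ((1 - gain P' v') ^+ 2 - gain P' v' ^+ 2 / n%:R) * \sum_j (x j - x j ^+ 2).
Proof.
set g := gain P' v'; set al := alpha_star d n m P' v'.
(* The quadratic is expanded in y - y^2, y and 1, since y - y^2 is nonnegative on [0,1] and zero at
   both endpoints. *)
have E y : coordinate_risk P' v' y =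
    (g ^+ 2 / n%:R - (1 - g) ^+ 2) * (y - y ^+ 2)
    + (1 - g) ^+ 2 * (1 - 2 * m%:R / d%:R) * y
    + ((1 - g) ^+ 2 * (m%:R / d%:R) ^+ 2 + al ^+ 2 * v').
  by rewrite /coordinate_risk -/g -/al; ring.
under eq_bigr do rewrite E.
rewrite 2!big_split /= -!mulr_sumr sumr_const card_ord -[_ *+ d]mulr_natl.
rewrite /worst_case_risk -/g -/al; field.
by rewrite !gt_eqF.
Qed.

Definition extremal_params : 'rV[R]_d := \row_k (k < m)%:R.

Lemma sum_extremal_params : \sum_k extremal_params 0 k = m%:R.
Proof.
have md' : (m <= d)%N.
  by rewrite -(ler_nat R); have := md; have := M0; lra.
under eq_bigr do rewrite mxE.
rewrite -natr_sum; congr (_%:R).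
rewrite -(big_mkord xpredT (fun k => nat_of_bool (k < m)%N)) (@big_cat_nat _ _ _ m)//=.
rewrite big_nat_cond (eq_bigr (fun=> 1%N)); last first.
  by move=> k /andP[/andP[_ ->]].
rewrite -big_nat_cond sum_nat_const_nat subn0 muln1 big_nat_cond big1 ?addn0//.
by move=> k /andP[/andP[mk _] _]; rewrite ltnNge mk.
Qed.

Lemma extremal_params_sparse : sparse_params d m extremal_params.
Proof.
split; last by rewrite sum_extremal_params.
by move=> k; rewrite mxE; case: (k < m)%N; rewrite ?ler01 ?lexx.
Qed.

Lemma sum_coordinate_risk_extremal (P' v' : R) :
  \sum_j coordinate_risk P' v' (extremal_params 0 j) = worst_case_risk P' v'.
Proof.
rewrite sum_coordinate_risk sum_extremal_params subrr mulr0 subr0.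
rewrite [X in _ * X]big1 ?mulr0 ?subr0// => k _.
by rewrite mxE; case: (k < m)%N; rewrite ?expr1n ?expr0n subrr.
Qed.

Lemma sum_coordinate_risk_le (P' v' : R) (theta : 'rV[R]_d) :
  gain P' v' ^+ 2 / n%:R <= (1 - gain P' v') ^+ 2 ->
  sparse_params d m theta ->
  \sum_j coordinate_risk P' v' (theta 0 j) <= worst_case_risk P' v'.
Proof.
move=> c0 [theta01 thetam]; rewrite sum_coordinate_risk -addrA -opprD lerBlDr lerDl.
have K : 0 <= 1 - 2 * m%:R / d%:R :> R.
  by rewrite subr_ge0 ler_pdivrMr// mul1r.
apply: addr_ge0; apply: mulr_ge0; rewrite ?subr_ge0//.
  by apply: mulr_ge0 => //; exact: sqr_ge0.
apply: sumr_ge0 => j _; have /andP[t0 t1] := theta01 j.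
by rewrite subr_ge0 expr2 ler_piMl.
Qed.

End risk.

Lemma R_robust_eq (R : realType) (d n m : nat) (P v0 vpri : R)
    (disp : measure_display) (T : measurableType disp)
    (Pr : 'rV[R]_d -> probability T R)
    (U : 'I_n -> T -> {ffun 'I_d -> bool})
    (Zpri : 'I_n -> T -> 'rV[R]_d) (Z : T -> 'rV[R]_d) :
  let v' := v0 + n%:R * vpri in
  let P' := P - vpri in
  (0 < n)%N -> (0 < m)%N -> 2 * m%:R <= d%:R :> R -> 0 <= vpri -> 0 <= v0 ->
  gain d n m P' v' ^+ 2 / n%:R <= (1 - gain d n m P' v') ^+ 2 ->
  (forall theta, sparse_params d m theta ->
     bernoulli_channel_model (Pr theta) theta vpri v0 U Zpri Z) ->
  R_robust m P v0 vpri Pr U Zpri Z = (worst_case_risk d n m P' v')%:E.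
Proof.
move=> v' P' n0 m0 md vpri0 v00 c0 model.
have riskE theta : sparse_params d m theta ->
    ('E_(Pr theta)[(fun t => sqnorm2 (theta_hat n m P' v'
       (received m P' U Zpri Z t) - theta))%R] =
     (\sum_j coordinate_risk d n m P' v' (theta 0 j))%:E)%E.
  move=> th.
  pose X j t : R := alpha_star d n m P' v' * received m P' U Zpri Z t 0 j
    + (beta_star d n m P' v' - theta 0 j).
  transitivity ('E_(Pr theta)[(fun t => \sum_j X j t ^+ 2)%R])%E.
    congr expectation; apply/funext => t; rewrite /sqnorm2; apply: eq_bigr => j _.
    by rewrite /theta_hat /X; move: (received _ _ _ _ _ _) => y; rewrite !mxE; ring.
  rewrite expectation_sum_sqr => [|j]; last first.
    have mr := measurable_received m P' vpri0 v00 (model _ th) j.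
    apply: measurable_funD => //; exact: measurable_funM.
  rewrite -sumEFin; apply: eq_bigr => j _.
  rewrite (expectation_sqr_received m P' vpri0 v00 (model _ th)).
  by rewrite coordinate_riskE.
apply/eqP; rewrite eq_le; apply/andP; split.
- apply: ge_ereal_sup => _ [theta th <-].
  by rewrite riskE// lee_fin sum_coordinate_risk_le.
- apply: ereal_sup_ubound; exists (extremal_params R d m).
    exact: extremal_params_sparse.
  rewrite riskE ?sum_coordinate_risk_extremal//.
  exact: extremal_params_sparse.
Qed.

(** * Gain and worst-case risk in the two noise regimes *)

Section regimes.
Context (R : realType) (d n m : nat) (P' v' eps : R).
Hypotheses (n0 : (0 < n)%N) (m0 : (0 < m)%N).
Hypothesis md : 2 * m%:R <= d%:R :> R.
Hypotheses (P'0 : 0 < P') (eps0 : 0 < eps).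
Hypothesis v'E : v' = d%:R / (2 * eps) * P'.

Let D0 : 0 < d%:R :> R.
Proof. by rewrite (lt_le_trans _ md)// mulr_gt0// ltr0n. Qed.
Let M0 : 0 < m%:R :> R. Proof. by rewrite ltr0n. Qed.
Let N0 : 0 < n%:R :> R. Proof. by rewrite ltr0n. Qed.
Let DM0 : 0 < d%:R - m%:R :> R.
Proof. by have := md; have := M0; lra. Qed.
Let v'0 : 0 < v'.
Proof. by rewrite v'E mulr_gt0// divr_gt0// mulr_gt0. Qed.
Let sqrtN0 : 0 < Num.sqrt n%:R :> R. Proof. by rewrite sqrtr_gt0. Qed.
Let sqrtP0 : 0 < Num.sqrt P'. Proof. by rewrite sqrtr_gt0. Qed.
Let S0 : 0 < odds_sum d m :> R. Proof. exact: odds_sum_gt0. Qed.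

Section low_noise.
Hypothesis low : low_noise d n m P' v'.

Let alphaE : alpha_star d n m P' v' =
  (Num.sqrt n%:R * Num.sqrt P' * odds_sum d m * (Num.sqrt n%:R + 1))^-1.
Proof. by rewrite /alpha_star low sqrtrM ?ler0n. Qed.

Lemma gain_low_noise :
  gain d n m P' v' = Num.sqrt n%:R / (Num.sqrt n%:R + 1).
Proof.
(* Writing n as r^2 with r its square root leaves a rational identity. *)
rewrite /gain alphaE; move: (sqr_sqrtr (ltW N0)) sqrtN0.
move: (Num.sqrt n%:R) => r <- r0.
by field; rewrite !gt_eqF// addr_gt0.
Qed.

(** Both sides equal 1/(sqrt n + 1)^2: this tuning cancels the dependence of the risk on the sum of
    theta_j - theta_j^2. *)
Lemma gain_low_noise_le :
  gain d n m P' v' ^+ 2 / n%:R <= (1 - gain d n m P' v') ^+ 2.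
Proof.
rewrite gain_low_noise; move: (sqr_sqrtr (ltW N0)) sqrtN0.
move: (Num.sqrt n%:R) => r <- r0; rewrite le_eqVlt; apply/orP; left.
by apply/eqP; field; rewrite !gt_eqF// addr_gt0.
Qed.

Lemma worst_case_risk_low_noise :
  worst_case_risk d n m P' v' =
  m%:R / (Num.sqrt n%:R + 1) ^+ 2 *
  ((d%:R - m%:R) / d%:R +
   d%:R / (2 * n%:R * eps) * (d%:R / (m%:R * odds_sum d m ^+ 2))).
Proof.
rewrite /worst_case_risk gain_low_noise alphaE v'E.
move: (sqr_sqrtr (ltW P'0)) sqrtP0; move: (Num.sqrt P') => q <- q0.
move: (sqr_sqrtr (ltW N0)) sqrtN0; move: (Num.sqrt n%:R) => r <- r0.
by field; rewrite !gt_eqF// addr_gt0.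
Qed.

End low_noise.

Section high_noise.
Hypothesis high : ~ low_noise d n m P' v'.

Let W0 : 0 < v' + n%:R ^+ 2 * P'.
Proof. by rewrite addr_gt0// mulr_gt0// exprn_gt0. Qed.

(** Since m (d-m) times the square of [odds_sum] is d^2, the factor d^2 comes out of the
    denominator. *)
Let alphaE : alpha_star d n m P' v' =
  m%:R * (d%:R - m%:R) * n%:R * Num.sqrt P' * odds_sum d m /
  (d%:R ^+ 2 * (v' + n%:R ^+ 2 * P')).
Proof.
rewrite /alpha_star; case: ifP => // _; congr (_ / _).
by rewrite odds_sum_sqr//; field; rewrite !gt_eqF.
Qed.

Lemma gain_high_noise :
  gain d n m P' v' = n%:R ^+ 2 * P' / (v' + n%:R ^+ 2 * P').
Proof.
rewrite /gain alphaE.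
(* The square roots are grouped into even powers so that their squares can be substituted. *)
transitivity (m%:R * (d%:R - m%:R) * n%:R ^+ 2 * Num.sqrt P' ^+ 2 * odds_sum d m ^+ 2
  / (d%:R ^+ 2 * (v' + n%:R ^+ 2 * P'))).
  by field; rewrite !gt_eqF.
rewrite odds_sum_sqr// (sqr_sqrtr (ltW P'0)).
by field; rewrite !gt_eqF.
Qed.

(** With W = v' + n^2 P', one has 1 - g = v'/W and g^2/n = n^3 P'^2/W^2, so the claim is the square
    of the hypothesis. *)
Lemma gain_high_noise_le : n%:R `^ (3 / 2) * P' <= v' ->
  gain d n m P' v' ^+ 2 / n%:R <= (1 - gain d n m P' v') ^+ 2.
Proof.
move=> v'_ge; rewrite gain_high_noise.
have N3 : (n%:R `^ (3 / 2)) ^+ 2 = n%:R ^+ 3 :> R.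
  rewrite -[in LHS]powR_mulrn ?powR_ge0// -powRrM.
  by rewrite divfK ?pnatr_eq0// powR_mulrn ?ler0n.
have : n%:R ^+ 3 * P' ^+ 2 <= v' ^+ 2.
  rewrite -N3 -exprMn ler_sqr ?nnegrE ?mulr_ge0 ?powR_ge0 ?(ltW P'0) ?(ltW v'0)//.
move=> h; rewrite -subr_ge0.
rewrite (_ : _ - _ = (v' ^+ 2 - n%:R ^+ 3 * P' ^+ 2) / (v' + n%:R ^+ 2 * P') ^+ 2).
  by rewrite divr_ge0 ?subr_ge0 ?sqr_ge0.
by field; rewrite !gt_eqF.
Qed.

Lemma worst_case_risk_high_noise :
  worst_case_risk d n m P' v' =
  m%:R * (1 / (d%:R / (d%:R - m%:R) +
               n%:R * (2 * n%:R * eps / d%:R) *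
               (m%:R * odds_sum d m ^+ 2 / d%:R))).
Proof.
have a2 : alpha_star d n m P' v' ^+ 2 =
    m%:R * (d%:R - m%:R) * n%:R ^+ 2 * P' /
    (d%:R ^+ 2 * (v' + n%:R ^+ 2 * P') ^+ 2).
  rewrite alphaE.
  transitivity (m%:R ^+ 2 * (d%:R - m%:R) ^+ 2 * n%:R ^+ 2 * Num.sqrt P' ^+ 2 *
      odds_sum d m ^+ 2 / (d%:R ^+ 2 * (v' + n%:R ^+ 2 * P')) ^+ 2).
    by field; rewrite !gt_eqF.
  rewrite odds_sum_sqr// (sqr_sqrtr (ltW P'0)).
  by field; rewrite !gt_eqF.
rewrite /worst_case_risk a2 gain_high_noise odds_sum_sqr//.
have e0 : 0 < d%:R + n%:R ^+ 2 * (2 * eps).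
  by rewrite addr_gt0// mulr_gt0 ?exprn_gt0 ?mulr_gt0.
(* As v' is proportional to P', so is this sum, and P' cancels from the risk. *)
have WE : v' + n%:R ^+ 2 * P' = (d%:R + n%:R ^+ 2 * (2 * eps)) * P' / (2 * eps).
  by rewrite v'E; field; rewrite gt_eqF.
rewrite WE v'E; field.
rewrite (_ : n%:R * (2 * n%:R * eps) = n%:R ^+ 2 * (2 * eps)); last by ring.
by rewrite !gt_eqF.
Qed.

End high_noise.
End regimes.

(** The bound 2 eps sigma0^2 <= d P makes the first entry of the maximum the active one; beyond it
    the local noise is 0 and v'/P' = sigma0^2/P exceeds d/(2 eps). In the second regime n^(3/2) P'
    <= v' is a separate condition: for m < d/2 the factor d^2/(4m(d-m)) exceeds 1, and if v' <
    n^(3/2) P' there, the constant vector m/d has risk above the stated value. *)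
Theorem corollary3 (R : realType) (d n m : nat) (P sigma0 eps : R)
    (disp : measure_display) (T : measurableType disp)
    (Pr : 'rV[R]_d -> probability T R)
    (U : 'I_n -> T -> {ffun 'I_d -> bool})
    (Zpri : 'I_n -> T -> 'rV[R]_d) (Z : T -> 'rV[R]_d) :
  let vpri := sigma_pri2 d n P (sigma0 ^+ 2) eps in
  let v' := sigma0 ^+ 2 + n%:R * vpri in
  let P' := P - vpri in
  (0 < d)%N -> (0 < n)%N -> (0 < m)%N ->
  m%:R / d%:R <= 1 / 2 :> R ->
  0 < P -> 0 <= sigma0 -> 0 < eps ->
  2 * eps * sigma0 ^+ 2 <= d%:R * P ->
  (forall theta, sparse_params d m theta ->
     bernoulli_channel_model (Pr theta) theta vpri (sigma0 ^+ 2) U Zpri Z) ->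
  (d%:R ^+ 2 / (4 * m%:R * (d%:R - m%:R)) * v' <= n%:R `^ (3 / 2) * P' ->
     R_robust m P (sigma0 ^+ 2) vpri Pr U Zpri Z =
     (m%:R / (Num.sqrt n%:R + 1) ^+ 2 *
      ((d%:R - m%:R) / d%:R +
       d%:R / (2 * n%:R * eps) *
       (d%:R / (m%:R * (Num.sqrt ((d%:R - m%:R) / m%:R) +
                        Num.sqrt (m%:R / (d%:R - m%:R))) ^+ 2))))%:E) /\
  (~ (d%:R ^+ 2 / (4 * m%:R * (d%:R - m%:R)) * v' <= n%:R `^ (3 / 2) * P') ->
     n%:R `^ (3 / 2) * P' <= v' ->
     R_robust m P (sigma0 ^+ 2) vpri Pr U Zpri Z =
     (m%:R *
      (1 / (d%:R / (d%:R - m%:R) +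
            n%:R * (2 * n%:R * eps / d%:R) *
            (m%:R * (Num.sqrt ((d%:R - m%:R) / m%:R) +
                     Num.sqrt (m%:R / (d%:R - m%:R))) ^+ 2 / d%:R))))%:E).
Proof.
move=> vpri v' P' d0 n0 m0 md2 P0 _ eps0 noise model.
have D0 : 0 < d%:R :> R by rewrite ltr0n.
have N0 : 0 < n%:R :> R by rewrite ltr0n.
have md : 2 * m%:R <= d%:R :> R.
  by move: md2; rewrite ler_pdivrMr// mulrAC mul1r ler_pdivlMr// mulrC.
have v00 : 0 <= sigma0 ^+ 2 by exact: sqr_ge0.
have W0 : 0 < 2 * eps * n%:R + d%:R by rewrite addr_gt0// !mulr_gt0.
have vpriE : vpri = (d%:R * P - 2 * eps * sigma0 ^+ 2) / (2 * eps * n%:R + d%:R).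
  by rewrite /vpri /sigma_pri2 max_l// divr_ge0 ?subr_ge0// ltW.
have vpri0 : 0 <= vpri by rewrite /vpri /sigma_pri2 le_max lexx orbT.
(* P' and v' are 2 eps and d times the same positive quantity (n P + sigma0^2)/(2 eps n + d); this
   gives the sign of P' and the ratio v'/P'. *)
have P'E : P' = 2 * eps * (n%:R * P + sigma0 ^+ 2) / (2 * eps * n%:R + d%:R).
  by rewrite /P' vpriE; field; rewrite gt_eqF.
have P'0 : 0 < P'.
  by rewrite P'E divr_gt0// !mulr_gt0// ltr_wpDr// mulr_gt0.
have v'E : v' = d%:R / (2 * eps) * P'.
  by rewrite /v' P'E vpriE; field; rewrite !gt_eqF.
split=> [low|high v'_ge].
- have le := gain_low_noise_le n0 m0 md P'0 low.
  rewrite (R_robust_eq n0 m0 md vpri0 v00 le model).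
  by rewrite (worst_case_risk_low_noise n0 m0 md P'0 eps0 v'E low).
- have le := gain_high_noise_le n0 m0 md P'0 eps0 v'E high v'_ge.
  rewrite (R_robust_eq n0 m0 md vpri0 v00 le model).
  by rewrite (worst_case_risk_high_noise n0 m0 md P'0 eps0 v'E high).
Qed.
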